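(* Let $F$ be an algebraically closed field of characteristic zero, let $R=M_{n,m}(F)$ be a non-trivial matrix superalgebra with a superinvolution $*$, and let $G$ be a finite abelian group. Then $R$ admits no fine $G$-gradings compatible with $*$. That is, there is no fine $G$-grading $R=\bigoplus_{g\in G}R_g$ of the superalgebra $R$ such that $(R_g)^*=R_g$ for all $g\in G$.
   Context: $M_{n,m}(F)$ denotes the associative algebra $M_{n+m}(F)$ of block matrices $\begin{pmatrix}A&B\\C&D\end{pmatrix}$ ($A$ of size $n\times n$, $D$ of size $m\times m$) with the $\mathbb{Z}_2$-grading $R=R_{\bar 0}\oplus R_{\bar 1}$ in which $R_{\bar 0}$ consists of the matrices with $B=0$, $C=0$ and $R_{\bar 1}$ of those with $A=0$, $D=0$. It is non-trivial if $R_{\bar 1}\neq 0$, i.e. $n,m\ge 1$. A superinvolution on an associative superalgebra $R$ is a $\mathbb{Z}_2$-graded linear map $*:R\to R$ of order 2 such that $(ab)^*=(-1)^{|a||b|}b^*a^*$ for all homogeneous $a,b\in R$. A $G$-grading of a superalgebra $R$ is a decomposition $R=\bigoplus_{g\in G}R_g$ with $R_gR_h\subseteq R_{gh}$ and $R_g=(R_g\cap R_{\bar 0})\oplus(R_g\cap R_{\bar 1})$ for all $g,h\in G$. It is fine if $\dim R_g=1$ for every $g$ with $R_g\ne\{0\}$. *)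

(* Defs.v *)
From HB Require Import structures.
From mathcomp Require Import all_boot all_order all_algebra all_fingroup.

Set Implicit Arguments.
Unset Strict Implicit.
Unset Printing Implicit Defensive.

Import GRing.Theory.
Local Open Scope ring_scope.

Section MatrixSuperalgebra.

Variables (F : fieldType) (n m : nat).

Local Notation R := 'M[F]_(n + m).

(* Parities are booleans, [true] being odd. The block projections are written
   as compositions because [ulsubmx] and the like carry no linear structure,
   which [linfun] needs to be meaningful. *)
Definition super_part (odd : bool) : {vspace R} :=
  let ul (x : R) : 'M[F]_n := (lsubmx \o usubmx) x in
  let ur (x : R) : 'M[F]_(n, m) := (rsubmx \o usubmx) x in
  let dl (x : R) : 'M[F]_(m, n) := (lsubmx \o dsubmx) x in
  let dr (x : R) : 'M[F]_m := (rsubmx \o dsubmx) x in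
  if odd then (lker (linfun ul) :&: lker (linfun dr))%VS
  else (lker (linfun ur) :&: lker (linfun dl))%VS.

Lemma mem_super_part (odd : bool) (x : R) :
  (x \in super_part odd) =
    if odd then (ulsubmx x == 0) && (drsubmx x == 0)
    else (ursubmx x == 0) && (dlsubmx x == 0).
Proof. by case: odd; rewrite memv_cap !memv_ker !lfunE. Qed.

Definition nontrivial_super : Prop := super_part true <> 0%VS.

Definition superinvolution (star : 'End(R)) : Prop :=
  [/\ forall a : bool, (star @: super_part a <= super_part a)%VS,
      involutive star
    & forall (a b : bool) (x y : R),
        x \in super_part a -> y \in super_part b ->
        star (x *m y) = (-1) ^+ (a && b) *: (star y *m star x)].

Variable G : finGroupType.

Definition super_grading (gr : G -> {vspace R}) : Prop :=
  [/\ (\sum_g gr g)%VS = fullv,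
      directv (\sum_g gr g),
      forall (g h : G) (x y : R),
        x \in gr g -> y \in gr h -> x *m y \in gr (g * h)%g
    & forall g : G,
        let U := (gr g :&: super_part false)%VS in
        let V := (gr g :&: super_part true)%VS in
        gr g = (U + V)%VS /\ directv (U + V)].

Definition fine_grading (gr : G -> {vspace R}) : Prop :=
  forall g : G, gr g <> 0%VS -> \dim (gr g) = 1%N.

Definition star_compatible (star : 'End(R)) (gr : G -> {vspace R}) : Prop :=
  forall g : G, (star @: gr g)%VS = gr g.

End MatrixSuperalgebra.

Arguments nontrivial_super F n m : clear implicits.

(* Main.v *)
(** Let [x] be odd and homogeneous.  Since [star] is an involution preserving
    lines, it multiplies each homogeneous element by a sign, and applying it to
    [x y] gives [x y = ± y x] for every homogeneous [y].  Hence [x ^ 2] is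
    central, so [x ^ 2 = c] is a scalar, and
    [c = star c = - (star x) ^ 2 = - c], so that [x ^ 2 = 0].  Then
    [x y x = ± x ^ 2 y = 0] for all homogeneous [y], hence for all [y], which
    forces [x = 0] because the matrix algebra is prime. *)
Require Import Defs.
From mathcomp Require Import all_boot all_order all_algebra all_fingroup.

Set Implicit Arguments.
Unset Strict Implicit.
Unset Printing Implicit Defensive.

Import GRing.Theory.
Local Open Scope ring_scope.

(** With [y] the matrix unit [delta_mx j i], the [(i, j)] entry of [x *m y *m x] is the square of
    [x i j]. *)
Lemma mulmx_prime_eq0 (F : fieldType) (N : nat) (x : 'M[F]_N) :
  (forall y : 'M_N, x *m y *m x = 0) -> x = 0.
Proof.
move=> xyx0; apply/matrixP=> i j; rewrite mxE; apply/eqP.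
suff: x i j * x i j == 0 by rewrite mulf_eq0 orbb.
have /matrixP/(_ i j) := xyx0 (delta_mx j i); rewrite [RHS]mxE => <-.
rewrite mxE (bigD1 i) //= big1 ?addr0 => [|k /negPf ki].
  rewrite mxE (bigD1 j) //= big1 ?addr0 => [|k /negPf kj].
    by rewrite mxE !eqxx mulr1.
  by rewrite mxE kj mulr0.
by rewrite mxE big1 ?mul0r // => l _; rewrite mxE ki andbF mulr0.
Qed.

(** Comparing the [(i, 0)] entries of both products with [delta_mx j 0] gives [z i j] on one side,
    and [z 0 0] or zero on the other as [i = j] or not. *)
Lemma central_mx_scalar (F : fieldType) (N : nat) (z : 'M[F]_N) :
  (forall y : 'M_N, z *m y = y *m z) -> exists c, z = c%:M.
Proof.
case: N z => [|N] z zC; first by exists 0; rewrite flatmx0 [RHS]flatmx0.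
exists (z 0 0); apply/matrixP=> i j.
have /matrixP/(_ i 0) := zC (delta_mx j 0).
rewrite mxE (bigD1 j) //= big1 ?addr0 => [|k /negPf kj]; last first.
  by rewrite mxE kj mulr0.
rewrite !mxE !eqxx mulr1 => ->.
rewrite (bigD1 0) //= big1 ?addr0 => [|k /negPf k0]; last first.
  by rewrite mxE k0 andbF mul0r.
by rewrite mxE eqxx andbT mulr_natl.
Qed.

Lemma involutive_line_sign (F : fieldType) (vT : vectType F) (f : 'End(vT))
    (L : {vspace vT}) (x : vT) :
  involutive f -> (f @: L <= L)%VS -> (\dim L <= 1)%N -> x \in L ->
  exists s : bool, f x = (-1) ^+ s *: x.
Proof.
move=> ff fL dL xL; have [->|x0] := eqVneq x 0.
  by exists false; rewrite linear0 scaler0.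
have LE : L = <[x]>%VS.
  apply/esym/eqP; rewrite eqEdim -memvE xL dim_vline x0; exact: dL.
have /vlineP[k fx] : f x \in <[x]>%VS.
  by rewrite -LE; apply: (subvP fL); apply: memv_img.
have /eqP : x = (k * k) *: x by rewrite -{1}[x]ff fx linearZ /= fx scalerA.
rewrite -subr_eq0 -{1}[x]scale1r -scalerBl scaler_eq0 (negPf x0) orbF subr_eq0.
rewrite eq_sym -expr2 sqrf_eq1 => /orP[]/eqP kE.
- by exists false; rewrite fx kE.
- by exists true; rewrite fx kE.
Qed.

Lemma superinvolution1 (F : fieldType) (n m : nat) (star : 'End('M[F]_(n + m))) :
  superinvolution star -> star 1%:M = 1%:M.
Proof.
case=> [starP starK starM].
have even1 : (1%:M : 'M[F]_(n + m)) \in super_part F n m false.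
  by rewrite mem_super_part scalar_mx_block block_mxKur block_mxKdl !eqxx.
have evens1 : star 1%:M \in super_part F n m false.
  by apply: (subvP (starP false)); apply: memv_img.
(* Since 1 is even, no sign appears when [star] is applied to [1 *m star 1]. *)
have := starM _ _ _ _ even1 evens1.
by rewrite mul1mx starK mul1mx expr0 scale1r.
Qed.

Section Grading.

Variables (F : fieldType) (n m : nat) (G : finGroupType).
Variables (star : 'End('M[F]_(n + m))) (gr : G -> {vspace 'M[F]_(n + m)}).
Hypothesis grP : super_grading gr.

(** Elements homogeneous for both [G] and the parity span the algebra. This reduces centrality of
    [x *m x] and vanishing of [x *m y *m x] to such [y]. *)
Lemma graded_linear_eq0 (f : {linear 'M[F]_(n + m) -> 'M[F]_(n + m)}) :
  (forall g b y, y \in gr g -> y \in super_part F n m b -> f y = 0) ->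
  forall y, f y = 0.
Proof.
case: grP => [grF _ _ grUV] f0 y.
have : y \in (\sum_g gr g)%VS by rewrite grF memvf.
case/memv_sumP=> v vP ->; rewrite linear_sum big1 // => g _.
have := vP g isT; rewrite (grUV g).1.
case/memv_addP=> u /memv_capP[ug u0] [w /memv_capP[wg w1] ->].
by rewrite linearD /= (f0 _ _ _ ug u0) (f0 _ _ _ wg w1) addr0.
Qed.

Hypothesis two_neq0 : 2%:R != 0 :> F.
Hypothesis starP : superinvolution star.
Hypothesis fine_gr : fine_grading gr.
Hypothesis star_gr : star_compatible star gr.

Lemma fine_star_sign g x : x \in gr g -> exists s : bool, star x = (-1) ^+ s *: x.
Proof.
case: starP => _ starK _; apply: involutive_line_sign => //.
  by rewrite star_gr.
by have [->|/eqP/fine_gr->] := eqVneq (gr g) 0%VS; rewrite ?dimv0.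
Qed.

(** The product [x *m y] is again homogeneous, so [star] acts by a sign on [x], [y] and [x *m y];
    the superinvolution rule then relates the two products. *)
Lemma fine_commute_sign g h a b x y :
  x \in gr g -> x \in super_part F n m a ->
  y \in gr h -> y \in super_part F n m b ->
  exists s : bool, y *m x = (-1) ^+ s *: (x *m y).
Proof.
case: grP => _ _ grM _; case: starP => _ _ starM xg xa yh yb.
have [s xyE] := fine_star_sign (grM _ _ _ _ xg yh).
have [[p px] [q qy]] := (fine_star_sign xg, fine_star_sign yh).
move: xyE; rewrite (starM _ _ _ _ xa yb) px qy -scalemxAl -scalemxAr !scalerA.
rewrite -!signr_addb => /(congr1 ( *:%R ((-1) ^+ (a && b (+) q (+) p)))).
by rewrite !scalerA -!signr_addb addbb scale1r => ->; eexists.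
Qed.

Lemma fine_odd_eq0 g x : x \in gr g -> x \in super_part F n m true -> x = 0.
Proof.
move=> xg x1; case: (starP) => _ _ starM.
have xxC y : (x *m x) *m y = y *m (x *m x).
  apply/eqP; rewrite -subr_eq0; apply/eqP.
  apply: (@graded_linear_eq0 (mulmx (x *m x) \- mulmxr (x *m x))) => h b {}y yh yb /=.
  have [s yx] := fine_commute_sign xg x1 yh yb.
  (* Moving [y] past [x] twice produces the same sign twice, and it cancels. *)
  rewrite [y *m _]mulmxA yx -scalemxAl -[x *m y *m x]mulmxA yx -scalemxAr scalerA.
  by rewrite -signr_addb addbb scale1r mulmxA subrr.
have [c xxE] := central_mx_scalar xxC.
have xx0 : x *m x = 0.
  have [s sx] := fine_star_sign xg.
  have := starM _ _ _ _ x1 x1.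
  rewrite sx -scalemxAl -scalemxAr !scalerA -mulrA -signr_addb addbb mulr1 scaleN1r.
  (* So far [star (x *m x) = - (x *m x)]; but [star] fixes scalar matrices, hence twice [x *m x] is
     zero. *)
  rewrite {1}xxE -scalemx1 linearZ /= (superinvolution1 starP) scalemx1 -xxE.
  move/eqP; rewrite -addr_eq0 -mulr2n -scaler_nat scaler_eq0 (negPf two_neq0).
  by move/eqP.
apply: mulmx_prime_eq0.
apply: (@graded_linear_eq0 (mulmxr x \o mulmx x)) => h b y yh yb /=.
have [s yx] := fine_commute_sign xg x1 yh yb.
by rewrite -mulmxA yx -scalemxAr mulmxA xx0 mul0mx scaler0.
Qed.

Lemma fine_odd_part_eq0 : super_part F n m true = 0%VS.
Proof.
case: grP => grF _ _ grUV; apply/eqP; rewrite -subv0; apply/subvP=> w.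
have : w \in super_part F n m false.
  (* Every component has zero odd part, so the even part is everything; the odd [w] is then also
     even, and all four of its blocks vanish. *)
  suff /subvP-> : (fullv <= super_part F n m false)%VS by rewrite ?memvf.
  rewrite -grF; apply/subv_sumP=> g _; rewrite (grUV g).1 subv_add capvSr /=.
  by apply/subvP=> y /memv_capP[yg /(fine_odd_eq0 yg)->]; rewrite mem0v.
rewrite !mem_super_part memv0 => /andP[/eqP ur /eqP dl] /andP[/eqP ul /eqP dr].
by rewrite -[w]submxK ur dl ul dr block_mx0.
Qed.

End Grading.

Theorem theorem4p3 (F : closedFieldType) (n m : nat)
    (star : 'End('M[F]_(n + m))) (G : finGroupType) :
  [pchar F] =i pred0 ->
  nontrivial_super F n m ->
  superinvolution star ->
  abelian [set: G] ->
  ~ exists gr : G -> {vspace 'M[F]_(n + m)},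
      [/\ super_grading gr, fine_grading gr & star_compatible star gr].
Proof.
move=> charF nontriv starP _ [gr [grP fine_gr star_gr]].
have two_neq0 : 2%:R != 0 :> F by have := charF 2%N; rewrite !inE /= => ->.
exact/nontriv/(fine_odd_part_eq0 grP two_neq0 starP fine_gr star_gr).
Qed.
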